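(* Let $d\ge1$ and let $p$ be a prime. Let $a(I,J)$ and $a^\vee(I,J)$, for equinumerous subsets $I,J\subset\mathbf Z/d$, be the rational numbers defined by $$L_I=\sum_{|J|=|I|}a(I,J)N_J,\qquad P_I=\sum_{|J|=|I|}a^\vee(I,J)L_J$$ in $R=\mathbf Q[l_0,\dots,l_{d-1}]/(l_0^2,\dots,l_{d-1}^2)$. Then for all equinumerous $I,J\subset\mathbf Z/d$, $$\left(p^d+(-1)^{|I|}\right)a(I,J)=a^\vee(J^c,I^c).$$
   Context: Indices are taken in $\mathbf Z/d$. In the graded $\mathbf Q$-algebra $R=\mathbf Q[l_0,\dots,l_{d-1}]/(l_0^2,\dots,l_{d-1}^2)$, for $i\in\mathbf Z/d$ put $N_i=pl_i-l_{i+1}$ and $P_i=pl_i+l_{i+1}$, and for $I\subset\mathbf Z/d$ put $L_I=\prod_{i\in I}l_i$, $N_I=\prod_{i\in I}N_i$, $P_I=\prod_{i\in I}P_i$ (empty products equal $1$). For each $m$ the families $(L_I)_{|I|=m}$ and $(N_I)_{|I|=m}$ are both bases of the degree $m$ part of $R$, so the coefficients are well defined. $I^c=\mathbf Z/d\setminus I$. (Geometrically, $R$ is the rational Chow ring of $G\text{-}\mathrm{Zip}^\mu$ for $\tilde G=\mathrm{Res}_{\mathbf F_{p^d}/\mathbf F_p}\mathrm{SL}(2)$ and $N_J$ is the class of a zip stratum closure.) *)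

(* Defs.v *)
From HB Require Import structures.
From mathcomp Require Import all_boot all_order all_algebra ring_quotient.
From mathcomp Require Import boolp mpoly.

Set Implicit Arguments.
Unset Strict Implicit.
Unset Printing Implicit Defensive.

Import GRing.Theory.
Local Open Scope ring_scope.
Local Open Scope quotient_scope.

(* The ideal (l_0^2, ..., l_(d-1)^2), made boolean classically because
   {ideal_quot _} takes boolean predicates. *)
Definition sq_ideal (d : nat) : {pred {mpoly rat[d]}} :=
  fun f => `[< exists h : 'I_d -> {mpoly rat[d]},
                 f = \sum_(i < d) h i * 'X_i ^+ 2 >].

Lemma sq_ideal_closed (d : nat) : idealr_closed (@sq_ideal d).
Proof.
split.
- apply/asboolP; exists (fun=> 0); rewrite big1 // => i _; exact: mul0r.
- apply/asboolP => -[h /(congr1 (mcoeff 0%MM))].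
  rewrite mcoeff1 eqxx raddf_sum /= big1 => [/eqP|i _].
    by rewrite oner_eq0.
  by rewrite rmorphM rmorphXn /= mcoeffX mnm1_eq0 expr0n mulr0.
- move=> c u v /asboolP[h ->] /asboolP[k ->].
  apply/asboolP; exists (fun i => c * h i + k i).
  rewrite mulr_sumr -big_split /=; apply: eq_bigr => i _.
  by rewrite mulrDl mulrA.
Qed.

HB.instance Definition _ (d : nat) :=
  isIdealr.Build {mpoly rat[d]} (@sq_ideal d) (@sq_ideal_closed d).

Definition Rsq (d : nat) : Type := {ideal_quot (@sq_ideal d)}.
HB.instance Definition _ (d : nat) := GRing.ComNzRing.on (Rsq d).

Definition Rpi (d : nat) (f : {mpoly rat[d]}) : Rsq d :=
  \pi_{ideal_quot (@sq_ideal d)} f.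

Section RatAlgebra.
Variable d : nat.

Lemma Rpi_is_zmod : zmod_morphism (@Rpi d).
Proof. by move=> f g; rewrite /Rpi rmorphB. Qed.
Lemma Rpi_is_monoid : monoid_morphism (@Rpi d).
Proof. by split=> [|f g]; rewrite /Rpi ?rmorph1 ?rmorphM. Qed.
HB.instance Definition _ :=
  GRing.isZmodMorphism.Build {mpoly rat[d]} (Rsq d) (@Rpi d) Rpi_is_zmod.
HB.instance Definition _ :=
  GRing.isMonoidMorphism.Build {mpoly rat[d]} (Rsq d) (@Rpi d) Rpi_is_monoid.

Definition Rscale (c : rat) (x : Rsq d) : Rsq d := Rpi c%:MP * x.

Lemma RscaleA a b x : Rscale a (Rscale b x) = Rscale (a * b) x.
Proof. by rewrite /Rscale mulrA -rmorphM -mpolyCM. Qed.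
Lemma Rscale1 : left_id 1 Rscale.
Proof. by move=> x; rewrite /Rscale mpolyC1 rmorph1 mul1r. Qed.
Lemma RscaleDr : right_distributive Rscale +%R.
Proof. by move=> a x y; rewrite /Rscale mulrDr. Qed.
Lemma RscaleDl x : {morph Rscale^~ x : a b / a + b}.
Proof. by move=> a b; rewrite /Rscale mpolyCD rmorphD mulrDl. Qed.

HB.instance Definition _ := GRing.Zmodule_isLmodule.Build rat (Rsq d)
  RscaleA Rscale1 RscaleDr RscaleDl.

Lemma RscaleAl (a : rat) (x y : Rsq d) : a *: (x * y) = (a *: x) * y.
Proof. exact: mulrA. Qed.
HB.instance Definition _ := GRing.Lmodule_isLalgebra.Build rat (Rsq d) RscaleAl.

Lemma RscaleAr (a : rat) (x y : Rsq d) : a *: (x * y) = x * (a *: y).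
Proof. exact: mulrCA. Qed.
HB.instance Definition _ := GRing.Lalgebra_isAlgebra.Build rat (Rsq d) RscaleAr.

End RatAlgebra.

(* Z/d is represented by 'I_d, with ordS as i |-> i + 1 ('Z_d would be wrong
   for d = 1). *)
Section Classes.
Variables (d p : nat).
Implicit Types (i : 'I_d) (I : {set 'I_d}).

Definition lcls i : Rsq d := Rpi 'X_i.
Definition Ncls i : Rsq d := p%:R * lcls i - lcls (ordS i).
Definition Pcls i : Rsq d := p%:R * lcls i + lcls (ordS i).

Definition Lset I : Rsq d := \prod_(i in I) lcls i.
Definition Nset I : Rsq d := \prod_(i in I) Ncls i.
Definition Pset I : Rsq d := \prod_(i in I) Pcls i.

End Classes.

(* Main.v *)
Require Import Defs.
From mathcomp Require Import all_boot all_order all_algebra.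
From mathcomp Require Import ring_quotient boolp mpoly.

(** With [N_J P_(K^c) = 0] for equinumerous [J <> K], because
[N_i P_i = p^2 l_i^2 - l_(i+1)^2 = 0], multiplying the expansion of [L_I] by
[P_(K^c)] isolates [a(I,K) N_K P_(K^c)]; expanding [P_(K^c)] instead leaves
[a^vee(K^c,I^c)] times the top class [L]. Finally
[N_K P_(K^c) = (p^d + (-1)^|K|) L]: in the product of the [p l_i +- l_(i+1)],
a mixed choice of first and second terms around the cycle repeats some
[l_j]. *)

Import GRing.Theory.
Local Open Scope ring_scope.

(** The shift is transitive: [d - i0 + j] applications of [ordS] carry a point [i0] of [S] to any
    given [j]. *)
Lemma ordS_closed_setT (d : nat) (S : {set 'I_d}) :
  S != set0 -> (forall i, i \in S -> ordS i \in S) -> S = setT.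
Proof.
case/set0Pn=> i0 Si0 closedS; apply/setP=> j; rewrite inE.
have iterE k : (iter k (@ordS d) i0 : nat) = ((i0 + k) %% d)%N.
  elim: k => [|k IHk] /=; first by rewrite addn0 modn_small.
  by rewrite IHk addnS -addn1 modnDml addn1.
suff <- : iter (d - i0 + j) (@ordS d) i0 = j.
  by elim: (_ + _)%N => //= k; exact: closedS.
apply: val_inj; rewrite /= iterE addnA subnKC; last exact: ltnW.
by rewrite modnDl modn_small.
Qed.

(** Expand over the set [S] of factors contributing their first term: only [S = setT] and [S = set0]
    survive. These are distinct choices because [0 < d]. *)
Lemma prod_cyclic_binomial (R : comNzRingType) (d : nat) (f u v : 'I_d -> R) :
  (0 < d)%N -> (forall i, f i * f i = 0) ->
  \prod_i (u i * f i + v i * f (ordS i)) =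
  (\prod_i u i + \prod_i v i) * \prod_i f i.
Proof.
move=> d_gt0 ff0; rewrite bigA_distr /=.
have neT0 : set0 != [set: 'I_d].
  by rewrite eq_sym; apply/set0Pn; exists (Ordinal d_gt0); rewrite inE.
rewrite (bigD1 setT) //= (bigD1 set0) //= [X in _ + (_ + X)]big1 ?addr0.
  rewrite mulrDl; congr (_ + _).
    by rewrite -big_split; apply: eq_bigr => i _; rewrite inE.
  rewrite [X in _ = _ * X](reindex_inj (@ordS_inj d)) -big_split /=.
  by apply: eq_bigr => i _; rewrite inE.
move=> S /andP[neST neS0].
(* Otherwise [~: S] would be nonempty and closed under [ordS], hence everything. *)
have [i niS SiS] : exists2 i, i \notin S & ordS i \in S.
  have [i /andP[niS SiS]|noi] := pickP [pred i | (i \notin S) && (ordS i \in S)].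
    by exists i.
  case/eqP: neS0; rewrite -[S]setCK (ordS_closed_setT _ (~: S)) ?setCT //.
    by apply: contra neST => /eqP cS0; rewrite -[S]setCK cS0 setC0.
  move=> i; rewrite !inE => niS; apply/negP=> SiS.
  by have := noi i; rewrite /= niS SiS.
(* The factors at [i] and at [ordS i] both contribute [f (ordS i)], whose square is zero. *)
rewrite (bigD1 i) //= (bigD1 (ordS i)) /=; last first.
  by apply: contra niS => /eqP <-.
by rewrite (negbTE niS) SiS mulrA mulrACA ff0 mulr0 mul0r.
Qed.

Section SquareZeroAlgebra.
Variables (d p : nat).
Implicit Types (i : 'I_d) (I J K : {set 'I_d}).

Lemma Rpi_eq0 f : (@Rpi d f == 0) = (f \in @sq_ideal d).
Proof.
rewrite -(rmorph0 (@Rpi d)) /Rpi -[f in RHS]subr0 -Quotient.equivE.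
exact: eqquotE.
Qed.

Lemma lcls_sqr i : lcls i * lcls i = 0.
Proof.
rewrite /lcls -rmorphM; apply/eqP; rewrite Rpi_eq0; apply/asboolP.
exists (fun j => (j == i)%:R); rewrite (bigD1 i) //= eqxx mul1r.
by rewrite big1 ?addr0 ?expr2 // => j /negbTE->; rewrite mul0r.
Qed.

Lemma mul_Ncls_Pcls i : Ncls p i * Pcls p i = 0.
Proof.
by rewrite /Ncls /Pcls -subr_sqr exprMn !expr2 !lcls_sqr mulr0 subr0.
Qed.

Lemma mul_Nset_Pset I J : ~~ [disjoint I & J] -> Nset p I * Pset p J = 0.
Proof.
case/pred0Pn=> i /andP[/= Ii Ji].
rewrite /Nset /Pset (bigD1 i Ii) (bigD1 i Ji) /=.
by rewrite mulrACA mul_Ncls_Pcls mul0r.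
Qed.

Lemma mul_Lset I J : ~~ [disjoint I & J] -> Lset I * Lset J = 0.
Proof.
case/pred0Pn=> i /andP[/= Ii Ji].
rewrite /Lset (bigD1 i Ii) (bigD1 i Ji) /=.
by rewrite mulrACA lcls_sqr mul0r.
Qed.

Lemma mul_LsetC I : Lset (~: I) * Lset I = Lset setT.
Proof.
rewrite mulrC /Lset [RHS](bigID (mem I)) /=; congr (_ * _).
  by apply: eq_bigl => i; rewrite inE.
by apply: eq_bigl => i; rewrite !inE.
Qed.

(** The monomial with all exponents 1 is divisible by no ['X_i ^+ 2], so its coefficient vanishes on
    the whole ideal. *)
Lemma Lset_setT_neq0 : Lset [set: 'I_d] != 0.
Proof.
rewrite /Lset /lcls -rmorph_prod Rpi_eq0; apply/asboolP=> -[h].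
pose m : 'X_{1.. d} := Multinom [tuple 1%N | i < d].
have m1 i : m i = 1%N by rewrite multinomE tnth_mktuple.
have -> : \prod_(i in [set: 'I_d]) 'X_i
          = 'X_[m] :> {mpoly rat[d]}.
  rewrite mpolyXE_id; apply: eq_big => [i|i _]; first by rewrite inE.
  by rewrite m1 expr1.
move/(congr1 (mcoeff m)); rewrite mcoeffX eqxx raddf_sum /= big1.
  by move/eqP; rewrite oner_eq0.
move=> i _; rewrite mcoeffM big1 // => k /eqP mE.
rewrite mpolyXn mcoeffX; case: eqP => [kE|]; last by rewrite mulr0.
have := congr1 (fun n : 'X_{1.. d} => n i) mE.
by rewrite /= m1 -kE mnmDE mulmnE mnm1E eqxx addnC.
Qed.

Lemma Nset_PsetC K : (0 < d)%N ->
  Nset p K * Pset p (~: K) = (p%:R ^+ d + (-1) ^+ #|K|) *: Lset setT.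
Proof.
(* The signs [s] merge both kinds of factors into one cyclic product; their product is
   [(-1) ^+ #|K|]. *)
move=> d_gt0; pose s i : Rsq d := if i \in K then -1 else 1.
transitivity (\prod_i (p%:R * lcls i + s i * lcls (ordS i))).
  rewrite [RHS](bigID (mem K)) /=; congr (_ * _); apply: eq_big => i.
  - by [].
  - by move=> Ki; rewrite /Ncls /s Ki mulN1r.
  - by rewrite inE.
  - by rewrite inE => nKi; rewrite /Pcls /s (negbTE nKi) mul1r.
rewrite prod_cyclic_binomial //; last exact: lcls_sqr.
rewrite prodr_const card_ord -big_mkcond prodr_const.
have -> : \prod_i lcls i = Lset [set: 'I_d] by apply: eq_bigl => i; rewrite inE.
rewrite -mulr_algl; congr (_ * _).
by rewrite -in_algE rmorphD !rmorphXn rmorphN1 rmorph_nat.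
Qed.

End SquareZeroAlgebra.

Theorem proposition4p5p9 (d p : nat) (d_ge1 : (1 <= d)%N) (p_prime : prime p)
    (a av : {set 'I_d} -> {set 'I_d} -> rat)
    (aE : forall I : {set 'I_d},
      Lset I = \sum_(J : {set 'I_d} | #|J| == #|I|) a I J *: Nset p J)
    (avE : forall I : {set 'I_d},
      Pset p I = \sum_(J : {set 'I_d} | #|J| == #|I|) av I J *: Lset J)
    (I J : {set 'I_d}) (eqIJ : #|I| = #|J|) :
  (p%:R ^+ d + (-1) ^+ #|I|) * a I J = av (~: J) (~: I).
Proof.
have LP_a : Lset I * Pset p (~: J) =
            ((p%:R ^+ d + (-1) ^+ #|I|) * a I J) *: Lset setT.
  rewrite aE mulr_suml (bigD1 J) ?eqIJ //= big1 => [|K /andP[/eqP cardK neKJ]].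
    by rewrite addr0 -scalerAl Nset_PsetC // scalerA mulrC.
  rewrite -scalerAl mul_Nset_Pset ?scaler0 //.
  (* If [K] misses [~: J], then [K] lies in [J], and equal cardinality forces [K = J]. *)
  apply: contra neKJ; rewrite disjoints_subset setCK => sKJ.
  by rewrite eqEcard sKJ cardK leqnn.
have LP_av : Lset I * Pset p (~: J) = av (~: J) (~: I) *: Lset setT.
  have cardC : #|~: I| = #|~: J| by rewrite [LHS]cardsCs [RHS]cardsCs !setCK eqIJ.
  rewrite avE mulr_sumr (bigD1 (~: I)) ?cardC //= big1 => [|K].
    by rewrite addr0 -scalerAr mulrC mul_LsetC.
  case/andP=> /eqP cardK neKI; rewrite -scalerAr mul_Lset ?scaler0 //.
  apply: contra neKI; rewrite disjoint_sym disjoints_subset => sKI.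
  by rewrite eqEcard sKI cardK cardC leqnn.
(* A nonzero difference of the two scalars would be invertible in [rat], yet it annihilates the
   nonzero top class. *)
apply/eqP; rewrite -subr_eq0; apply/negPn/negP=> c_neq0.
case/eqP: (Lset_setT_neq0 d); rewrite -[Lset _](scalerK c_neq0).
by rewrite scalerBl -LP_a -LP_av subrr scaler0.
Qed.
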